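(* For every positive integer $k$, $$\mathrm{SgnAltrun}_{4k}(p,q)=\mathrm{SgnAltrun}_{4k+1}(p,q)=2(1-p)(1-q)(1-pq)^{2(k-1)},$$ and $$\mathrm{SgnAltrun}_{4k+2}(p,q)=\mathrm{SgnAltrun}_{4k+3}(p,q)=0.$$
   Context: Let $\mathfrak{S}_n$ be the symmetric group on $[n]=\{1,\dots,n\}$, with permutations written in one-line notation $\pi=\pi_1\pi_2\cdots\pi_n$. Let $\mathrm{inv}(\pi)=|\{1\le i<j\le n:\pi_i>\pi_j\}|$. A peak of $\pi$ is an index $2\le i\le n-1$ with $\pi_{i-1}<\pi_i>\pi_{i+1}$, and a valley is an index $2\le i\le n-1$ with $\pi_{i-1}>\pi_i<\pi_{i+1}$; $\mathrm{pk}(\pi)$ and $\mathrm{val}(\pi)$ denote the numbers of peaks and valleys. Define $\mathrm{SgnAltrun}_n(p,q)=\sum_{\pi\in\mathfrak{S}_n}(-1)^{\mathrm{inv}(\pi)}p^{\mathrm{pk}(\pi)}q^{\mathrm{val}(\pi)}$. *)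

(* Defs.v *)
From mathcomp Require Import all_boot all_fingroup all_algebra.
From mathcomp Require Import mpoly.
Set Implicit Arguments.
Unset Strict Implicit.
Unset Printing Implicit Defensive.
Import GRing.Theory.

(* Positions and values are 0-based: both range over 'I_n, so the position i
   in [n] is here i - 1, and 2 <= i <= n - 1 reads 0 < i and i.+1 < n. *)

Definition num_inv n (s : 'S_n) : nat :=
  #|[set ij : 'I_n * 'I_n | (ij.1 < ij.2) && (s ij.2 < s ij.1)]|.

(* ord_pred and ordS wrap around cyclically; the first two conditions exclude
   exactly the two positions where this would happen. *)
Definition is_peak n (s : 'S_n) (i : 'I_n) : bool :=
  [&& 0 < i, i.+1 < n, s (ord_pred i) < s i & s (ordS i) < s i].

Definition is_valley n (s : 'S_n) (i : 'I_n) : bool :=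
  [&& 0 < i, i.+1 < n, s i < s (ord_pred i) & s i < s (ordS i)].

Definition pk n (s : 'S_n) : nat := #|[set i | is_peak s i]|.

(* val(s); the identifier val is the subtype projection. *)
Definition vly n (s : 'S_n) : nat := #|[set i | is_valley s i]|.

Local Open Scope ring_scope.

(* The indeterminates p and q of Z[p, q]. *)
Definition p : {mpoly int[2]} := 'X_(0 : 'I_2).
Definition q : {mpoly int[2]} := 'X_(1 : 'I_2).

Definition SgnAltrun (n : nat) : {mpoly int[2]} :=
  \sum_(s : 'S_n) (-1) ^+ num_inv s * p ^+ pk s * q ^+ vly s.

(* Main.v *)
Require Import Defs.
From mathcomp Require Import all_boot all_fingroup all_algebra.
From mathcomp Require Import mpoly.
From mathcomp Require Import ring zify.
Import GRing.Theory.
Local Open Scope ring_scope.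

(** Permutations of size [n + 1] arise from those of size [n] by appending a last
    value [v], which multiplies the sign by [(-1) ^ (n - v)]. The signed sum over
    the permutations ending in [v] is therefore, up to that sign, a combination
    of [low] and [high], the sums over the permutations of size [n] ending
    below, resp. not below, [v]. Because the sign alternates, after two such
    steps the sum over a pair of last values [2t], [2t + 1] depends on [low] and
    [high] at [2t] only, and the recurrences for [low] and [high] at even
    arguments decouple. Their solutions vanish except at the extreme [t]. *)

(* Throughout, [N] indexes the permutations of size [N + 1]. *)
Definition word {N} (s : 'S_N.+1) (i : nat) : nat := s (inord i).

Definition ends_asc {N} (s : 'S_N.+1) : bool :=
  ((0 < N) && (word s N.-1 < word s N))%N.
Definition ends_desc {N} (s : 'S_N.+1) : bool :=
  ((0 < N) && (word s N < word s N.-1))%N.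

Definition weight {n} (s : 'S_n) : {mpoly int[2]} :=
  (-1) ^+ num_inv s * p ^+ pk s * q ^+ vly s.

Lemma word_ord N (s : 'S_N.+1) (i : 'I_N.+1) : word s i = s i.
Proof. by rewrite /word inord_val. Qed.

Lemma word_lift_perm N (v : 'I_N.+2) (s : 'S_N.+1) i : (i <= N)%N ->
  word (lift_perm ord_max v s) i = bump v (word s i).
Proof.
move=> le_iN; rewrite /word.
have -> : inord i = lift ord_max (inord i : 'I_N.+1) :> 'I_N.+2.
  by apply: val_inj; rewrite [RHS]lift_max /= inordK ?inordK ?ltnS ?leqW.
by rewrite lift_perm_lift.
Qed.

Lemma word_lift_perm_max N (v : 'I_N.+2) (s : 'S_N.+1) :
  word (lift_perm ord_max v s) N.+1 = v.
Proof. by rewrite (word_ord _ _ ord_max) lift_perm_id. Qed.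

Lemma ltn_bump2 h i j : (bump h i < bump h j)%N = (i < j)%N.
Proof. by rewrite /bump; lia. Qed.

Lemma ltn_bump h i : (h < bump h i)%N = (h <= i)%N.
Proof. by rewrite /bump; lia. Qed.

Lemma bump_ltn h i : (bump h i < h)%N = (i < h)%N.
Proof. by rewrite /bump; lia. Qed.

(** * Inversions, peaks and valleys as sums over positions *)

Lemma num_invE n (s : 'S_n) :
  num_inv s = (\sum_(i < n) \sum_(j < n) ((i < j) && (s j < s i)))%N.
Proof.
rewrite /num_inv -sum1_card pair_big /= [RHS]big_mkcond /= big_mkcond /=.
by apply: eq_bigr => -[i j] _ /=; rewrite inE /=; case: (_ && _).
Qed.

(** A sum over a range of naturals lets the last interior position be split off when a value is
    appended. *)
Lemma card_interior N (P : pred 'I_N.+1) (Q : pred nat) :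
    (forall i : 'I_N.+1, P i = [&& 0 < i, i < N & Q i])%N ->
  #|[set i | P i]| = (\sum_(1 <= i < N) Q i)%N.
Proof.
move=> PE; rewrite -sum1_card; under eq_bigl do rewrite inE PE.
rewrite -(big_mkord (fun i => [&& 0 < i, i < N & Q i]%N) (fun=> 1%N)).
rewrite [LHS]big_mkcond /= big_ltn //= add0n.
case: N P PE => [|N] P PE; first by rewrite !big_geq.
rewrite big_nat_recr //= ltnn addn0.
by apply: eq_big_nat => i /andP[-> ->] /=; case: (Q i).
Qed.

Lemma word_ord_pred N (s : 'S_N.+1) (i : 'I_N.+1) :
  (0 < i)%N -> word s (ord_pred i) = word s i.-1.
Proof.
case: i => [[|i] //= lt_iN] _.
by rewrite -modnDmr modnn addn0 modn_small // ltnW.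
Qed.

Lemma word_ordS N (s : 'S_N.+1) (i : 'I_N.+1) :
  (i < N)%N -> word s (ordS i) = word s i.+1.
Proof. by move=> lt_iN; rewrite /= modn_small. Qed.

Lemma pkE N (s : 'S_N.+1) :
  pk s =
    (\sum_(1 <= i < N) ((word s i.-1 < word s i) && (word s i.+1 < word s i)))%N.
Proof.
apply: card_interior => i; rewrite /is_peak ltnS.
have [i0|//] := ltnP 0 i; have [iN|//] := ltnP i N.
by rewrite -!word_ord word_ord_pred // word_ordS.
Qed.

Lemma vlyE N (s : 'S_N.+1) :
  vly s =
    (\sum_(1 <= i < N) ((word s i < word s i.-1) && (word s i < word s i.+1)))%N.
Proof.
apply: card_interior => i; rewrite /is_valley ltnS.
have [i0|//] := ltnP 0 i; have [iN|//] := ltnP i N.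
by rewrite -!word_ord word_ord_pred // word_ordS.
Qed.

(** The new inversions pair the last position with each earlier value above [v]. *)
Lemma num_inv_lift_perm N (v : 'I_N.+2) (s : 'S_N.+1) :
  num_inv (lift_perm ord_max v s) = (num_inv s + (N.+1 - v))%N.
Proof.
have wE (i : 'I_N.+1) : widen_ord (leqnSn N.+1) i = lift ord_max i.
  by apply: val_inj; rewrite [RHS]lift_max.
rewrite !num_invE big_ord_recr /= [X in (_ + X)%N]big1 ?addn0; last first.
  by move=> j _; rewrite ltnNge -ltnS ltn_ord.
under eq_bigr => i _.
  rewrite big_ord_recr /= wE lift_perm_id !lift_perm_lift /= ltn_ord ltn_bump /=.
  under eq_bigr do rewrite wE lift_perm_lift /= ltn_bump2.
over.
rewrite big_split /=; congr addn.
(* As [s] is a bijection, counting positions with [v <= s i] amounts to counting the values from [v]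
   to [N]. *)
rewrite -(reindex_inj (@perm_inj _ s) (P := xpredT)
            (F := fun i : 'I_N.+1 => (v <= i)%N : nat)) /=.
rewrite -(big_mkord xpredT (fun i => (v <= i)%N : nat)).
rewrite (big_cat_nat (n := v)) //=; last by rewrite -ltnS.
rewrite big_nat big1 ?add0n => [|i /andP[_]]; last by rewrite ltnNge => /negbTE->.
rewrite -[RHS]muln1 -sum_nat_const_nat; apply: eq_big_nat => i /andP[-> //].
Qed.

(** Only position [N] can turn interior; [bump] keeps the order of the earlier values, and [v] lies
    below [bump v u] exactly when [v <= u]. *)
Lemma pk_lift_perm N (v : 'I_N.+2) (s : 'S_N.+1) :
  pk (lift_perm ord_max v s) = (pk s + (ends_asc s && (v <= word s N)))%N.
Proof.
rewrite !pkE /ends_asc; case: N v s => [|N] v s; first by rewrite !big_geq.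
rewrite big_nat_recr //= word_lift_perm_max !word_lift_perm // ltn_bump2 ltn_bump.
congr addn; apply: eq_big_nat => i /andP[_ iN].
rewrite !word_lift_perm ?ltn_bump2 //; lia.
Qed.

Lemma vly_lift_perm N (v : 'I_N.+2) (s : 'S_N.+1) :
  vly (lift_perm ord_max v s) = (vly s + (ends_desc s && (word s N < v)))%N.
Proof.
rewrite !vlyE /ends_desc; case: N v s => [|N] v s; first by rewrite !big_geq.
rewrite big_nat_recr //= word_lift_perm_max !word_lift_perm // ltn_bump2 bump_ltn.
congr addn; apply: eq_big_nat => i /andP[_ iN].
rewrite !word_lift_perm ?ltn_bump2 //; lia.
Qed.

(* [x] and [y] anticipate the peak, resp. valley, that the last position
   becomes when a smaller, resp. larger, value is appended. *)
Definition last_sum N (x y : {mpoly int[2]}) (v : nat) : {mpoly int[2]} :=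
  \sum_(s : 'S_N.+1 | word s N == v)
     weight s * (x ^+ ends_asc s * y ^+ ends_desc s).

(** Appending [j] after a smaller value can only create a valley, whence the parameters [1 q];
    otherwise it can only create a peak, whence [p 1]. *)
Definition low N j := \sum_(0 <= u < j) last_sum N 1 q u.
Definition high N j := \sum_(j <= u < N.+1) last_sum N p 1 u.

Lemma sum_last_sum N x y a b :
  \sum_(a <= u < b) last_sum N x y u =
  \sum_(s : 'S_N.+1 | (a <= word s N < b)%N)
     weight s * (x ^+ ends_asc s * y ^+ ends_desc s).
Proof.
rewrite /last_sum; under eq_bigr do rewrite big_mkcond.
rewrite exchange_big /= [RHS]big_mkcond; apply: eq_bigr => s _.
rewrite -big_mkcond /=; under eq_bigl do rewrite eq_sym.
by rewrite big_nat1_eq.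
Qed.

Lemma SgnAltrunE N : SgnAltrun N.+1 = \sum_(0 <= v < N.+1) last_sum N 1 1 v.
Proof.
rewrite sum_last_sum; apply: eq_big => s; first by rewrite /= ltn_ord.
by rewrite !expr1n !mulr1.
Qed.

Lemma last_sumS N x y v : (v <= N.+1)%N ->
  last_sum N.+1 x y v = (-1) ^+ (N.+1 - v) * (x * low N v + y * high N v).
Proof.
rewrite -ltnS => lt_v; pose v' := Ordinal lt_v.
rewrite /last_sum /low /high !sum_last_sum.
rewrite (reindex (lift_perm ord_max v')) /=; last first.
  (* The inverse of appending: delete position [i] and its value, then renumber the rest. The
     default [k] is never reached, as [s (lift i k)] differs from [s i]. *)
  pose ulsf i (s : 'S_N.+2) k := odflt k (unlift (s i) (s (lift i k))).
  have ulsfK i (s : 'S_N.+2) k : lift (s i) (ulsf i s k) = s (lift i k).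
    rewrite /ulsf; have:= neq_lift i k.
    by rewrite -(can_eq (permK s)) => /unlift_some[] ? ? ->.
  have inj_ulsf : injective (ulsf ord_max _).
    move=> s; apply: can_inj (ulsf (s ord_max) s^-1%g) _ => k'.
    by rewrite {1}/ulsf ulsfK !permK liftK.
  exists (fun s => perm (inj_ulsf s)) => [s _ | s].
    by apply/permP=> k'; rewrite permE /ulsf lift_perm_lift lift_perm_id liftK.
  rewrite inE (word_ord _ _ ord_max) => /eqP si0; apply/permP=> k.
  have {}si0 : s ord_max = v' by apply: val_inj.
  case: (unliftP ord_max k) => [k'|] ->; rewrite ?lift_perm_id //.
  by rewrite lift_perm_lift -si0 permE ulsfK.
under eq_bigl do rewrite word_lift_perm_max eqxx.
(* The new word ends in an ascent (factor [x]) if the old last value is below [v], and in a descent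
   (factor [y]) otherwise. *)
rewrite (bigID (fun s : 'S_N.+1 => (word s N < v)%N)) /= mulrDr.
congr +%R; rewrite mulrA mulr_sumr.
  apply: eq_bigr => s sv.
  rewrite /weight num_inv_lift_perm pk_lift_perm vly_lift_perm.
  rewrite /ends_asc /ends_desc /= word_lift_perm_max word_lift_perm //.
  rewrite bump_ltn ltn_bump /= sv [(v <= _)%N]leqNgt sv /=.
  rewrite andbF andbT addn0 !exprD expr1n expr0.
  by ring.
apply: eq_big => [s|s sv]; first by rewrite -leqNgt ltn_ord andbT.
rewrite /weight num_inv_lift_perm pk_lift_perm vly_lift_perm.
rewrite /ends_asc /ends_desc /= word_lift_perm_max word_lift_perm //.
rewrite bump_ltn ltn_bump /= (negbTE sv) [(v <= _)%N]leqNgt sv.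
rewrite andbF andbT addn0 !exprD expr1n expr0.
by ring.
Qed.

(** * Small cases and two-step recurrences *)

Lemma lowS N v : low N v.+1 = low N v + last_sum N 1 q v.
Proof. by rewrite /low big_nat_recr. Qed.

Lemma highE N v : (v <= N)%N -> high N v = last_sum N p 1 v + high N v.+1.
Proof. by move=> le_vN; rewrite /high big_ltn. Qed.

Lemma low0 N : low N 0 = 0.
Proof. exact: big_geq. Qed.

Lemma high_max N : high N N.+1 = 0.
Proof. exact: big_geq. Qed.

Lemma last_sum0 x y : last_sum 0 x y 0 = 1.
Proof.
transitivity (\sum_(0 <= v < 1) last_sum 0 x y v); first by rewrite big_nat1.
rewrite sum_last_sum.
rewrite (eq_bigl xpredT) => [|s]; last by rewrite ltn_ord.
rewrite (big_pred1 1%g) => [|s]; last first.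
  by apply/esym/eqP/permP=> i; rewrite !ord1.
rewrite /weight pkE vlyE num_invE !big_ord1 !big_geq //.
by rewrite /ends_asc /ends_desc /= !expr0 !mulr1.
Qed.

Lemma last_sum1_0 x y : last_sum 1 x y 0 = - y.
Proof.
rewrite (last_sumS 0) // low0 (highE 0) // high_max last_sum0.
by rewrite expr1; ring.
Qed.

Lemma last_sum1_1 x y : last_sum 1 x y 1 = x.
Proof.
rewrite (last_sumS 0) // (lowS 0) low0 high_max last_sum0.
by rewrite expr0; ring.
Qed.

(** The two summands carry opposite signs, so [low N.+1] and [high N.+1] cancel up to their
    increments at [t.*2], which one more step expresses at level [N]. *)
Lemma last_sum_pair N x y t : (t.*2 <= N.+1)%N ->
  last_sum N.+2 x y t.*2 + last_sum N.+2 x y t.*2.+1 =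
    x * (low N t.*2 + q * high N t.*2) - y * (p * low N t.*2 + high N t.*2).
Proof.
move=> le_tN; rewrite !last_sumS //; last exact: leqW.
rewrite (highE _ _ le_tN) lowS !last_sumS // !subSS (subSn le_tN) exprS.
set e := (-1) ^+ _; have ee : e * e = 1 by rewrite -expr2 sqrr_sign.
set A := low N _; set B := high N _; set C := low N.+1 _; set D := high N.+1 _.
transitivity (e * e * (x * (A + q * B) - y * (p * A + B))); first by ring.
by rewrite ee mul1r.
Qed.

(** For [x = 1], [y = q] the coefficient of [high] in [last_sum_pair] is [q - q = 0]; in
    [high_pair], [x = p], [y = 1] kills that of [low]. *)
Lemma low_pair N t : (t.*2 <= N.+1)%N ->
  low N.+2 t.+1.*2 = low N.+2 t.*2 + (1 - p * q) * low N t.*2.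
Proof.
move=> le_tN; rewrite doubleS !lowS -addrA last_sum_pair //.
by congr (_ + _); ring.
Qed.

Lemma high_pair N t : (t.*2 <= N.+1)%N ->
  high N.+2 t.*2 = high N.+2 t.+1.*2 + (p * q - 1) * high N t.*2.
Proof.
move=> le_tN; rewrite (highE N.+2) 1?leqW // (highE N.+2 t.*2.+1) //.
rewrite doubleS addrA last_sum_pair // addrC.
by congr (_ + _); ring.
Qed.

(** * Solution of the recurrences *)

Lemma low_eq0 N t : (t.*2 <= N)%N -> low N t.*2 = 0.
Proof.
elim/ltn_ind: N t => N IHN; elim=> [|t IHt]; first by rewrite low0.
case: N IHN IHt => [|[|N]] // IHN IHt le_tN; rewrite doubleS !ltnS in le_tN.
by rewrite low_pair ?leqW // IHt ?leqW // IHN // mulr0 addr0.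
Qed.

Lemma low_top m : low m.*2.+1 m.+1.*2 = (1 - q) * (1 - p * q) ^+ m.
Proof.
elim: m => [|m IHm].
  rewrite [low _ _](lowS 1 1) (lowS 1 0) low0 last_sum1_0 last_sum1_1.
  by rewrite expr0; ring.
rewrite (low_pair m.*2.+1 m.+1) // IHm low_eq0 ?exprS; [by ring | exact: leqnSn].
Qed.

Lemma last_sum_top m x y :
  last_sum m.+1.*2 x y m.+1.*2 = x * ((1 - q) * (1 - p * q) ^+ m).
Proof.
rewrite last_sumS // high_max mulr0 addr0 subnn mul1r.
by rewrite doubleS -(doubleS m) low_top.
Qed.

Lemma high_odd_eq0 m t : (0 < t <= m.+1)%N -> high m.*2.+1 t.*2 = 0.
Proof.
case/andP=> t_gt0; elim: m t t_gt0 => [|m IHm] t t_gt0 le_tm.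
  have -> : t = 1%N by lia.
  by rewrite high_max.
(* Downward induction on [t], starting at [t = m.+2], where [high] is an empty sum. *)
move def_d: (m.+2 - t)%N => d.
elim: d t t_gt0 le_tm def_d => [|d IHd] t t_gt0 le_tm def_d.
  have -> : t = m.+2 by lia.
  by rewrite high_max.
rewrite (high_pair m.*2.+1) ?(IHd t.+1) ?(IHm t) ?mulr0 ?addr0 //; lia.
Qed.

Lemma high_odd0 m : high m.*2.+1 0 = (p - 1) * (p * q - 1) ^+ m.
Proof.
elim: m => [|m IHm].
  rewrite [high _ _](highE 1 0) // (highE 1 1) // high_max.
  by rewrite last_sum1_0 last_sum1_1 expr0; ring.
rewrite (high_pair m.*2.+1 0) // (high_odd_eq0 m.+1 1) // IHm exprS; by ring.
Qed.

Lemma high_even_top m : high m.+1.*2 m.+1.*2 = p * ((1 - q) * (1 - p * q) ^+ m).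
Proof. by rewrite highE // high_max addr0 last_sum_top. Qed.

(* For [t = m - 1] the two terms of [high_pair], known from [high_even_top],
   cancel; below that both vanish by induction. *)
Lemma high_even_eq0 m t : (0 < t < m)%N -> high m.*2 t.*2 = 0.
Proof.
case/andP=> t_gt0; elim: m t t_gt0 => [|m IHm] t t_gt0 // lt_tm.
move def_d: (m - t)%N => d.
elim: d t t_gt0 lt_tm def_d => [|d IHd] t t_gt0 lt_tm def_d.
  have def_t : t = m by lia.
  case: m t_gt0 {IHm lt_tm def_d} def_t => [|m] t_gt0 def_t.
    by rewrite def_t in t_gt0.
  rewrite def_t (high_pair m.+1.*2) // (high_even_top m.+1) high_even_top exprS; by ring.
rewrite (high_pair m.*2) ?(IHd t.+1) ?(IHm t) ?mulr0 ?addr0 //; lia.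
Qed.

(** The nonzero top term enters only at [m = 0], where [p * (1 - q) + (p * q - 1) = p - 1]. *)
Lemma high_even0 m : high m.+1.*2 0 = (p - 1) * (p * q - 1) ^+ m.
Proof.
elim: m => [|m IHm].
  rewrite (high_pair 0 0) // (high_even_top 0) (highE 0) // high_max last_sum0.
  by rewrite !expr0; ring.
by rewrite (high_pair m.+1.*2 0) // (high_even_eq0 m.+2 1) // IHm exprS; ring.
Qed.

(** * Summation over all last values *)

Lemma sum_last_sum_pairs N k : (k.*2 <= N.+3)%N ->
  \sum_(0 <= v < k.*2) last_sum N.+2 1 1 v =
  \sum_(0 <= t < k) ((1 - p) * low N t.*2 + (q - 1) * high N t.*2).
Proof.
elim: k => [|k IHk] le_kN; first by rewrite !big_geq.
rewrite doubleS !big_nat_recr //= IHk; last by rewrite doubleS in le_kN; lia.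
rewrite -addrA last_sum_pair; last by rewrite doubleS in le_kN; lia.
by congr (_ + _); ring.
Qed.

(** Only two pairs survive: [t = 0] through [high] and [t = m.+1] through [low]. *)
Lemma SgnAltrun_even m : SgnAltrun m.*2.+4 =
  (1 - p) * (1 - q) * ((1 - p * q) ^+ m + (p * q - 1) ^+ m).
Proof.
rewrite SgnAltrunE (sum_last_sum_pairs m.*2.+1 m.+2) //.
rewrite big_nat_recr //= big_ltn // big_nat big1 => [|t]; last first.
  move=> /andP[t_gt0 lt_tm].
  rewrite low_eq0 ?high_odd_eq0 ?mulr0 ?addr0 //; lia.
by rewrite low0 low_top doubleS high_max high_odd0; ring.
Qed.

(** The largest last value stays unpaired. Its term joins the pair [t = m.+1], which now contributes
    through [high], by [(1 - p * q) - p * (1 - q) = 1 - p]. *)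
Lemma SgnAltrun_odd m : SgnAltrun m.*2.+4.+1 =
  (1 - p) * (1 - q) * ((1 - p * q) ^+ m + (p * q - 1) ^+ m).
Proof.
rewrite SgnAltrunE big_nat_recr //= (last_sum_top m.+1).
rewrite (sum_last_sum_pairs m.+1.*2 m.+2) //.
rewrite big_nat_recr //= big_ltn // big_nat big1 => [|t]; last first.
  move=> /andP[t_gt0 lt_tm].
  rewrite low_eq0 ?high_even_eq0 ?mulr0 ?addr0 //; lia.
rewrite low0 low_eq0 // high_even_top high_even0 exprS; by ring.
Qed.

Theorem theorem1 (k : nat) (hk : (0 < k)%N) :
  [/\ SgnAltrun (4 * k) = 2 * (1 - p) * (1 - q) * (1 - p * q) ^+ (2 * (k - 1)),
      SgnAltrun (4 * k + 1) = 2 * (1 - p) * (1 - q) * (1 - p * q) ^+ (2 * (k - 1)),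
      SgnAltrun (4 * k + 2) = 0
    & SgnAltrun (4 * k + 3) = 0].
Proof.
case: k hk => [//|k] _; rewrite subn1 /= mul2n.
have ->: (4 * k.+1 = k.*2.*2.+4)%N by lia.
have ->: (k.*2.*2.+4 + 2 = k.*2.+1.*2.+4)%N by lia.
have ->: (k.*2.*2.+4 + 3 = k.*2.+1.*2.+4.+1)%N by lia.
rewrite addn1 !SgnAltrun_even !SgnAltrun_odd.
(* The two powers agree for the even exponent [k.*2] and cancel for the odd exponent [k.*2.+1]. *)
have signE m : (p * q - 1) ^+ m = (-1) ^+ odd m * (1 - p * q) ^+ m.
  by rewrite -[p * q - 1]opprB (exprNn (1 - p * q)) signr_odd.
rewrite !signE /= odd_double expr0 expr1.
by split; ring.
Qed.
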